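(* Let $A=\{a_s(n_s)\}_{s=1}^k$ be a finite system of arithmetic sequences ($a_s\in\mathbb{Z}$, $n_s\in\mathbb{Z}^+$), and let $w$ be a function from $\mathbb{Z}$ to $\mathbb{Z}$ with period $n_0\in\mathbb{Z}^+$. Then $w$ is the covering function of $A$ (i.e. $w_A(x)=w(x)$ for all $x\in\mathbb{Z}$) if $w_A(x)=w(x)$ for $$\Big|\bigcup_{s=0}^k\Big\{0,\frac1{n_s},\ldots,\frac{n_s-1}{n_s}\Big\}\Big|\ \le\ n_0+n_1+\cdots+n_k-k$$ consecutive integers $x$ (the number of consecutive integers required is the left-hand side, and the displayed inequality holds). In particular, for any $m\in\mathbb{Z}^+$, $A$ forms an exact $m$-cover of $\mathbb{Z}$ if it covers $\big|\bigcup_{s=1}^k\{r/n_s:\ r=0,\ldots,n_s-1\}\big|$ consecutive integers exactly $m$ times.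
   Context: $\mathbb{Z}^+=\{1,2,3,\ldots\}$. For $a\in\mathbb{Z}$ and $n\in\mathbb{Z}^+$, $a(n)=a+n\mathbb{Z}=\{a+nx:\ x\in\mathbb{Z}\}$ is an arithmetic sequence with modulus $n$. The covering function of $A=\{a_s(n_s)\}_{s=1}^k$ is $w_A(x)=|\{1\le s\le k:\ x\in a_s(n_s)\}|$ for $x\in\mathbb{Z}$. $A$ covers an integer $x$ exactly $m$ times if $w_A(x)=m$, and $A$ is an exact $m$-cover of $\mathbb{Z}$ if $w_A(x)=m$ for all $x\in\mathbb{Z}$. The period $n_0$ of $w$ need not be its least period. *)

(* Defs.v *)
From HB Require Import structures.
From mathcomp Require Import all_boot all_order all_algebra finmap.

Set Implicit Arguments.
Unset Strict Implicit.
Unset Printing Implicit Defensive.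

Import Order.TTheory GRing.Theory Num.Theory.
Local Open Scope ring_scope.

(* Covering systems {a_s(n_s)}_{s = 1}^k are given by a : 'I_k -> int and
   n : 'I_k -> nat, so that the indices run over 0, ..., k - 1; the positivity
   of the moduli is a hypothesis. *)

(* The residue class a(n) = a + nZ; see arith_seqP. *)
Definition arith_seq (a : int) (n : nat) : {pred int} :=
  [pred x : int | (n%:Z %| x - a)%Z].

Lemma arith_seqP (a : int) (n : nat) (x : int) :
  reflect (exists y : int, x = a + n%:Z * y) (x \in arith_seq a n).
Proof.
rewrite inE; apply: (iffP dvdzP) => -[y] h; exists y.
  by rewrite mulrC -h addrC subrK.
by rewrite h addrAC subrr add0r mulrC.
Qed.

Definition covering_function (k : nat) (a : 'I_k -> int) (n : 'I_k -> nat)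
    (x : int) : nat :=
  #|[set s : 'I_k | x \in arith_seq (a s) (n s)]|.

Definition exact_cover (k : nat) (a : 'I_k -> int) (n : 'I_k -> nat)
    (m : nat) : Prop :=
  forall x : int, covering_function a n x = m.

Definition has_period (w : int -> int) (n0 : nat) : Prop :=
  forall x : int, w (x + n0%:Z) = w x.

Definition holds_on_consecutive (P : int -> Prop) (L : nat) : Prop :=
  exists x0 : int, forall i : nat, (i < L)%N -> P (x0 + i%:Z).

(* {0, 1/n, ..., (n - 1)/n} *)
Definition modulus_fractions (n : nat) : {fset rat} :=
  [fset (nat_of_ord r)%:Q / n%:Q | r in 'I_n]%fset.

Definition system_fractions (k : nat) (n : 'I_k -> nat) : {fset rat} :=
  (\bigcup_(s <- enum 'I_k) modulus_fractions (n s))%fset.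

(* Main.v *)
Require Import Defs.
From HB Require Import structures.
From mathcomp Require Import all_boot all_order all_algebra finmap.
From mathcomp Require Import cyclotomic algC zify.

Set Implicit Arguments.
Unset Strict Implicit.
Unset Printing Implicit Defensive.

Import Order.TTheory GRing.Theory Num.Theory.
Local Open Scope ring_scope.

(** Let the polynomial ring act on functions on the integers, the variable
    acting as the shift [f |-> f (_ + 1)]. A function of period [n] is killed
    by ['X^n - 1], hence so is every sum of functions with periods
    [n_0, ..., n_k] by any common multiple [P] of the ['X^(n_s) - 1]. The roots
    of ['X^n - 1] are simple and are the numbers [exp (2 pi i t)] for [t] among
    [0, 1/n, ..., (n-1)/n], so the product [P] of the linear factors over the
    union of these sets of fractions is a common multiple whose degree [L] is
    the cardinality of that union ([fractions_poly]).

    The difference between the covering function and [w] is such a sum: the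
    indicator of [a_s(n_s)] has period [n_s]. It therefore satisfies a linear
    recurrence of order [L] whose two extreme coefficients do not vanish, and
    such a sequence is zero as soon as [L] consecutive terms are zero, since
    the recurrence can be run in both directions ([recurrence_eq0]).

    The bound on [L] holds because [0] lies in all [k + 1] sets of fractions,
    and the statement on exact covers is the case of a constant [w], with
    period [1]: the only fraction it adds is [0]. *)

(** * Polynomials in the shift operator *)

Section ShiftAction.

Variable R : comNzRingType.
Implicit Types (p q : {poly R}) (f g : int -> R) (x : int).

Definition shift_action p f x : R := \sum_(i < size p) p`_i * f (x + i%:Z).

Lemma shift_action_wide p f x m :
  (size p <= m)%N -> shift_action p f x = \sum_(i < m) p`_i * f (x + i%:Z).
Proof.
move=> le_pm; rewrite /shift_action.
rewrite (big_ord_widen _ (fun i => p`_i * f (x + i%:Z)) le_pm) big_mkcond /=.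
apply: eq_bigr => i _; case: ltnP => // /(nth_default 0) ->.
by rewrite mul0r.
Qed.

Lemma shift_actionBl p q f x :
  shift_action (p - q) f x = shift_action p f x - shift_action q f x.
Proof.
have le_m : (size (p - q)%R <= maxn (size p) (size q))%N.
  by rewrite (leq_trans (size_polyD _ _)) // size_polyN.
rewrite (shift_action_wide _ _ le_m).
rewrite (shift_action_wide _ _ (leq_maxl _ (size q))).
rewrite (shift_action_wide _ _ (leq_maxr (size p) _)) -sumrB.
by apply: eq_bigr => i _; rewrite coefB mulrBl.
Qed.

Lemma shift_actionXnM n p f x :
  shift_action ('X^n * p) f x = shift_action p f (x + n%:Z).
Proof.
have le_m : (size ('X^n * p)%R <= n + size p)%N.
  by rewrite (leq_trans (size_polyMleq _ _)) // size_polyXn addSn.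
rewrite (shift_action_wide _ _ le_m) big_split_ord /= big1 ?add0r => [|i _].
  apply: eq_bigr => i _; rewrite coefXnM ltnNge leq_addr /= addKn.
  by rewrite PoszD addrA.
by rewrite coefXnM ltn_ord mul0r.
Qed.

Lemma shift_actionBr p f g x :
  shift_action p (fun y => f y - g y) x
    = shift_action p f x - shift_action p g x.
Proof. by rewrite -sumrB; apply: eq_bigr => i _; rewrite mulrBr. Qed.

Lemma shift_action_sumr (I : finType) p (F : I -> int -> R) x :
  shift_action p (fun y => \sum_s F s y) x = \sum_s shift_action p (F s) x.
Proof.
by rewrite exchange_big; apply: eq_bigr => i _; rewrite mulr_sumr.
Qed.

(** On ['X^n - 1] itself this is the definition of a period; the factor [q] acts
    by taking combinations of translates, and those of the zero function
    vanish. *)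
Lemma shift_action_periodic n q f x :
  (forall y, f (y + n%:Z) = f y) -> shift_action (q * ('X^n - 1)) f x = 0.
Proof.
move=> fP; rewrite mulrBr mulr1 mulrC shift_actionBl shift_actionXnM.
apply/eqP; rewrite subr_eq0; apply/eqP/eq_bigr => i _.
by rewrite addrAC fP.
Qed.

End ShiftAction.

(** The leading coefficient lets a window of [L] zeros slide to the right, the
    constant coefficient lets it slide to the left. *)
Lemma recurrence_eq0 (R : idomainType) (p : {poly R}) (f : int -> R) L :
    size p = L.+1 -> p`_0 != 0 -> (forall x, shift_action p f x = 0) ->
    holds_on_consecutive (fun x => f x = 0) L -> forall x, f x = 0.
Proof.
move=> szp p0 pf [x0 f_x0].
have pL : p`_L != 0.
  by have := lead_coef_eq0 p; rewrite lead_coefE szp -size_poly_eq0 szp => ->.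
have next y : (forall i, (i < L)%N -> f (y + i%:Z) = 0) -> f (y + L%:Z) = 0.
  move=> fy; have := pf y; rewrite /shift_action szp big_ord_recr big1 /=.
    by rewrite add0r => /eqP; rewrite mulf_eq0 (negPf pL) => /eqP.
  by move=> i _; rewrite fy ?mulr0.
have prev y : (forall i, (i < L)%N -> f (y + 1 + i%:Z) = 0) -> f y = 0.
  move=> fy; have := pf y; rewrite /shift_action szp big_ord_recl big1 /=.
    by rewrite !addr0 => /eqP; rewrite mulf_eq0 (negPf p0) => /eqP.
  by move=> i _; rewrite /bump PoszD addrA fy ?mulr0.
have window y : forall i, (i < L)%N -> f (y + i%:Z) = 0.
  rewrite -(subrK x0 y) addrC; elim: (y - x0) => [|d IHd|d IHd] i ltiL.
  (* The cases are y = x0, a move right to x0 + d.+1 and a move left to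
     x0 - d.+1. *)
  - by rewrite addr0 f_x0.
  - have [eqL|neqL] := eqVneq i.+1 L.
      by rewrite -addrA -PoszD addSnnS eqL PoszD addrA next.
    by rewrite -addrA -PoszD addSnnS PoszD addrA IHd // ltn_neqAle neqL.
  - case: i ltiL => [|i] ltiL.
      rewrite addr0; apply: prev => i ltiL'.
      have -> : x0 - d.+1%:Z + 1 + i%:Z = x0 - d%:Z + i%:Z by lia.
      exact: IHd.
    have -> : x0 - d.+1%:Z + i.+1%:Z = x0 - d%:Z + i%:Z by lia.
    by rewrite IHd // ltnW.
by move=> x; rewrite -(subrK L%:Z x) next //; apply: window.
Qed.

(** * Sets of fractions *)

Lemma modulus_fractionsP n (t : rat) :
  reflect (exists2 r : nat, (r < n)%N & t = r%:Q / n%:Q)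
          (t \in modulus_fractions n).
Proof.
apply: (iffP (imfsetP _ _ _ _)) => [[r _ ->]|[r ltrn ->]]; first by exists r.
by exists (Ordinal ltrn).
Qed.

Lemma system_fractionsP k (n : 'I_k -> nat) (t : rat) :
  reflect (exists s, t \in modulus_fractions (n s)) (t \in system_fractions n).
Proof.
apply: (iffP (bigfcupP _ _ _ _)) => [[s _ ts]|[s ts]]; first by exists s.
by exists s; rewrite ?mem_enum.
Qed.

Lemma mem0_modulus_fractions n : (0 < n)%N -> 0 \in modulus_fractions n.
Proof. by move=> n0; apply/modulus_fractionsP; exists 0%N; rewrite ?mul0r. Qed.

Lemma fraction_scale n d r :
  (0 < d)%N -> (r * d)%:Q / (n * d)%:Q = r%:Q / n%:Q.
Proof.
by move=> d0; rewrite !PoszM !intrM -mulf_div divff ?mulr1 // intr_eq0 -lt0n.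
Qed.

Lemma modulus_fractions_dvd n N : (0 < N)%N -> (n %| N)%N ->
  (modulus_fractions n `<=` modulus_fractions N)%fset.
Proof.
move=> N0 /dvdnP[d defN]; apply/fsubsetP => _ /modulus_fractionsP[r ltrn ->].
have d0 : (0 < d)%N by move: N0; rewrite defN muln_gt0 => /andP[].
apply/modulus_fractionsP; exists (r * d)%N.
  by rewrite defN mulnC ltn_pmul2l.
by rewrite defN [(d * n)%N]mulnC fraction_scale.
Qed.

Lemma card_modulus_fractions n : (#|` modulus_fractions n| <= n)%N.
Proof.
by rewrite (leq_trans (leq_imfset_card _ _ _)) //= size_enum_ord.
Qed.

(** With [z] a primitive [N]-th root of unity, the fraction [j/N] stands for
    [z ^+ j]; for [n] dividing [N], the fractions
    with denominator [n] then give exactly the powers of [z ^+ (N %/ n)], i.e.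
    the roots of ['X^n - 1]. The product is taken over the [j < N] with
    [j/N \in S], so that its degree is the cardinality of [S]. *)
Lemma fractions_poly N (S : {fset rat}) :
    (0 < N)%N -> (S `<=` modulus_fractions N)%fset ->
  exists2 P : {poly algC}, size P = #|` S|.+1 /\ P`_0 != 0 &
    forall n, (n %| N)%N -> (modulus_fractions n `<=` S)%fset ->
      exists q, P = q * ('X^n - 1).
Proof.
move=> N0 sSN; have [z zN] := C_prim_root_exists N0.
pose frac (j : nat) : rat := j%:Q / N%:Q.
have frac_inj : injective frac.
  have N_neq0 : N%:Q != 0 by rewrite intr_eq0 -lt0n.
  by move=> i j /(divIf N_neq0)/intr_inj[].
pose js := [seq j <- iota 0 N | frac j \in S].
have js_uniq : uniq js by rewrite filter_uniq ?iota_uniq.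
have mem_js j : (j \in js) = (j < N)%N && (frac j \in S).
  by rewrite mem_filter mem_iota add0n andbC.
pose P := \prod_(j <- js) ('X - (z ^+ j)%:P).
have rootP x : root P x = (x \in [seq z ^+ j | j <- js]).
  by rewrite -root_prod_XsubC big_map.
exists P => [|n n_dvd /fsubsetP sub_nS]; last first.
  apply/dvdpP.
  have n0 := dvdn_gt0 N0 n_dvd; have zn := dvdn_prim_root zN n_dvd.
  rewrite -(factor_Xn_sub_1 zn).
  rewrite -(big_map (fun i => (z ^+ (N %/ n)) ^+ i) xpredT
                    (fun u => 'X - u%:P)).
  apply: uniq_roots_dvdp.
    apply/allP => _ /mapP[r + ->]; rewrite mem_index_iota /= => ltrn.
    rewrite rootP -exprM mulnC map_f // mem_js.
    have defN : N = (n * (N %/ n))%N by rewrite mulnC divnK.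
    have d0 : (0 < N %/ n)%N by rewrite divn_gt0 // dvdn_leq.
    rewrite {2}defN ltn_pmul2r // ltrn /=.
    have -> : frac (r * (N %/ n))%N = r%:Q / n%:Q.
      by rewrite /frac {2}defN fraction_scale.
    by apply: sub_nS; apply/modulus_fractionsP; exists r.
  rewrite uniq_rootsE map_inj_in_uniq ?iota_uniq // => i j.
  rewrite !mem_index_iota /= => lti ltj /eqP.
  by rewrite (eq_prim_root_expr zn) !modn_small // => /eqP.
split.
  rewrite size_prod_XsubC; congr _.+1; rewrite -(size_map frac).
  apply/perm_size/uniq_perm; rewrite ?fset_uniq ?map_inj_uniq // => t.
  apply/mapP/idP => [[j + ->]|tS]; first by rewrite mem_js => /andP[].
  have /modulus_fractionsP[j ltjN def_t] := fsubsetP sSN t tS.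
  by exists j => //; rewrite mem_js ltjN /frac -def_t.
rewrite -horner_coef0 -[_ != 0]/(~~ root P 0) rootP.
apply/mapP => -[j _ /esym/eqP]; rewrite expf_eq0 => /andP[_ /eqP z0].
have /eqP := prim_expr_order zN.
by rewrite z0 expr0n -leqn0 leqNgt N0 eq_sym oner_eq0.
Qed.

(** * Covering functions *)

Lemma covering_functionE k (a : 'I_k -> int) (n : 'I_k -> nat) x :
  covering_function a n x = (\sum_s (x \in arith_seq (a s) (n s)))%N.
Proof.
by rewrite /covering_function cardsE -sum1_card big_mkcond.
Qed.

Lemma arith_seq_periodic a n x :
  (x + n%:Z \in arith_seq a n) = (x \in arith_seq a n).
Proof. by rewrite !inE addrAC rpredDr ?dvdzz. Qed.

(** The [k + 1] sets of fractions share [0]; what remains of each has fewer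
    elements than its modulus. *)
Lemma card_system_fractions k (n : 'I_k -> nat) n0 :
    (0 < n0)%N -> (forall s, (0 < n s)%N) ->
  (#|` modulus_fractions n0 `|` system_fractions n|%fset + k
     <= n0 + \sum_s n s)%N.
Proof.
move=> n0_gt0 n_gt0.
have card_neq0 m : (0 < m)%N -> (#|` modulus_fractions m `\ 0%R|%fset < m)%N.
  move=> m_gt0; have := card_modulus_fractions m.
  by rewrite (cardfsD1 0) mem0_modulus_fractions.
have bigU_neq0 (r : seq 'I_k) :
    (#|` (\bigcup_(s <- r) modulus_fractions (n s)) `\ 0%R|%fset + size r
       <= \sum_(s <- r) n s)%N.
  elim: r => [|s r IHr]; first by rewrite !big_nil fset0D cardfs0.
  rewrite !big_cons fsetDUl /= addnS -addSn.
  have := leq_card_fsetU (modulus_fractions (n s) `\ 0%R)%fset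
    ((\bigcup_(s <- r) modulus_fractions (n s)) `\ 0%R)%fset.
  have := card_neq0 _ (n_gt0 s); move: IHr => /= ? ? [? _]; lia.
have leU : (#|` system_fractions n `\ 0%R|%fset + k <= \sum_s n s)%N.
  rewrite (eq_bigl (fun s => s \in 'I_k)) // -big_enum -{2}(size_enum_ord k).
  exact: bigU_neq0.
rewrite (@cardfsD1 rat 0) in_fsetU mem0_modulus_fractions //= fsetDUl.
apply: leq_trans (leq_add (card_neq0 _ n0_gt0) leU).
rewrite add1n !addSn ltnS addnA leq_add2r.
exact: (leq_card_fsetU _ _).1.
Qed.

Lemma covering_function_eq k (a : 'I_k -> int) (n : 'I_k -> nat)
    (w : int -> int) n0 :
    (0 < n0)%N -> (forall s, (0 < n s)%N) -> has_period w n0 ->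
    holds_on_consecutive (fun x => (covering_function a n x)%:Z = w x)
      #|` (modulus_fractions n0 `|` system_fractions n)%fset| ->
  forall x, (covering_function a n x)%:Z = w x.
Proof.
move=> n0_gt0 n_gt0 w_per w_eq.
set S := (_ `|` _)%fset in w_eq.
(* Any common multiple of the moduli serves as a common denominator. *)
pose N := (n0 * \prod_s n s)%N.
have N_gt0 : (0 < N)%N by rewrite muln_gt0 n0_gt0 prodn_gt0.
have n_dvd s : (n s %| N)%N by rewrite dvdn_mull // (bigD1 s) //= dvdn_mulr.
have n0_dvd : (n0 %| N)%N by rewrite dvdn_mulr.
have sSN : (S `<=` modulus_fractions N)%fset.
  rewrite fsubUset modulus_fractions_dvd //=; apply/fsubsetP => t.
  case/system_fractionsP => s.
  exact/fsubsetP/modulus_fractions_dvd.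
have [P [szP P0] P_dvd] := fractions_poly N_gt0 sSN.
pose ind s x : algC := (x \in arith_seq (a s) (n s))%:R.
pose f x : algC := \sum_s ind s x - (w x)%:~R.
have fE x : f x = ((covering_function a n x)%:Z - w x)%:~R.
  by rewrite intrB covering_functionE -pmulrn natr_sum.
have f0 : forall x, f x = 0.
  apply: (recurrence_eq0 szP P0); last first.
    case: w_eq => x0 w_eq; exists x0 => i /w_eq.
    by rewrite fE => ->; rewrite subrr.
  move=> x; rewrite shift_actionBr shift_action_sumr.
  rewrite big1 ?sub0r => [|s _].
    have [|q ->] := P_dvd n0 n0_dvd; first exact: fsubsetUl.
    by rewrite shift_action_periodic ?oppr0 // => y; rewrite w_per.
  have [|q ->] := P_dvd (n s) (n_dvd s).
    apply/fsubsetP => t ts; rewrite inE; apply/orP; right.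
    by apply/system_fractionsP; exists s.
  by rewrite shift_action_periodic // => y; rewrite /ind arith_seq_periodic.
move=> x; apply/eqP; rewrite -subr_eq0 -(intr_eq0 algC) -fE.
exact/eqP/f0.
Qed.

Theorem corollary1p1 (k : nat) (a : 'I_k -> int) (n : 'I_k -> nat)
    (n_gt0 : forall s : 'I_k, (0 < n s)%N) :
  (forall (w : int -> int) (n0 : nat), (0 < n0)%N -> has_period w n0 ->
     let L := #|` (modulus_fractions n0 `|` system_fractions n)%fset| in
     L%:Z <= n0%:Z + \sum_(s < k) (n s)%:Z - k%:Z /\
     (holds_on_consecutive
        (fun x : int => (covering_function a n x)%:Z = w x) L ->
      forall x : int, (covering_function a n x)%:Z = w x)) /\
  (forall m : nat, (0 < k)%N -> (0 < m)%N ->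
     holds_on_consecutive
       (fun x : int => covering_function a n x = m)
       #|` system_fractions n| ->
     exact_cover a n m).
Proof.
split=> [w n0 n0_gt0 w_per L | m k_gt0 _ m_eq x].
  split; last exact: covering_function_eq.
  rewrite lerBrDr -PoszD (_ : \sum_s (n s)%:Z = (\sum_s n s)%N).
    by rewrite -PoszD lez_nat card_system_fractions.
  by rewrite (big_morph Posz PoszD (erefl _)).
have sub1 : (modulus_fractions 1 `<=` system_fractions n)%fset.
  apply/fsubsetP => _ /modulus_fractionsP[[|//] _ ->]; rewrite mul0r.
  apply/system_fractionsP; exists (Ordinal k_gt0).
  exact: mem0_modulus_fractions.
apply/eqP; rewrite -eqz_nat; apply/eqP.
apply: (covering_function_eq (n0 := 1) (w := fun=> m%:Z)) => //.
rewrite (fsetUidPr _ _ sub1).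
by case: m_eq => x0 m_eq; exists x0 => i /m_eq ->.
Qed.
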